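(* Let $1\leq s<n$ and let $M=(m_{ij})\in\mathbb Z^{(s,n)}$ be an integer $s\times n$ matrix with $\operatorname{rank} M=s$. Then \[ G:=\left\{\operatorname{diag}\left(a_1^{m_{11}},\ldots,a_1^{m_{1n}}\right)\cdots \operatorname{diag}\left(a_s^{m_{s1}},\ldots,a_s^{m_{sn}}\right);\ a_1,\ldots,a_s\in\mathbb C^*\right\} \] is a toral subgroup of $GL(n,\mathbb C)$. Defining relations for this group (as a subset of $GL(n,\mathbb C)$) are given by $t_1^{d_1}\cdots t_n^{d_n}=1$ for all integer vectors $(d_1,\ldots,d_n)^{\rm tr}\in\ker M$, where the $t_i$ denote the diagonal entries of the matrix, together with the condition that all off-diagonal entries are zero.
   Context: A linear algebraic group over $\mathbb K\in\{\mathbb R,\mathbb C\}$ is a subgroup of $GL(n,\mathbb K)$ which is also an algebraic subvariety (i.e. is cut out in $GL(n,\mathbb K)$ by polynomial equations in the matrix entries). A connected linear algebraic group $G\subseteq GL(n,\mathbb K)$ is called toral if there exists a semisimple matrix $B\in\mathbb K^{(n,n)}$ (semisimple: diagonalizable over $\mathbb C$) such that $\{\exp(tB);\ t\in\mathbb R\}$ is Zariski-dense in $G$. Here $\mathbb K=\mathbb C$. *)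

(* Defs.v *)
From HB Require Import structures.
From mathcomp Require Import all_boot all_order all_algebra.
From mathcomp Require Import all_classical all_reals all_analysis.
From mathcomp Require Import complex.
(* Only required, not imported: its notations clash with those of
   mathcomp-analysis. *)
From mathcomp Require mpoly.

Set Implicit Arguments.
Unset Strict Implicit.
Unset Printing Implicit Defensive.

Import Order.TTheory GRing.Theory Num.Theory.
Import numFieldNormedType.Exports.

Local Open Scope classical_set_scope.
Local Open Scope ring_scope.
Local Open Scope complex_scope.

Definition GLset (K : fieldType) (n : nat) : set 'M[K]_n :=
  [set A | A \in unitmx].

(* The n * n variables stand for the matrix entries, in the order of [mxvec]. *)
Definition mx_meval (K : fieldType) (n : nat)
    (p : mpoly.mpoly (n * n) K) (A : 'M[K]_n) : K :=
  mpoly.meval (fun k => mxvec A 0 k) p.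

(* Z is closed in GL(n, K) for the Zariski topology. *)
Definition zariski_closed (K : fieldType) (n : nat) (Z : set 'M[K]_n) : Prop :=
  exists S : set (mpoly.mpoly (n * n) K),
    Z = [set A | GLset A /\ forall p, S p -> mx_meval p A = 0].

Definition GL_subgroup (K : fieldType) (n : nat) (G : set 'M[K]_n) : Prop :=
  [/\ G `<=` @GLset K n,
      G 1%:M,
      forall A B, G A -> G B -> G (A *m B)
    & forall A, G A -> G (invmx A)].

Definition linear_algebraic_group (K : fieldType) (n : nat)
    (G : set 'M[K]_n) : Prop :=
  GL_subgroup G /\ zariski_closed G.

(* Connectedness in the Zariski topology. *)
Definition zariski_connected (K : fieldType) (n : nat)
    (G : set 'M[K]_n) : Prop :=
  forall Z1 Z2 : set 'M[K]_n,
    zariski_closed Z1 -> zariski_closed Z2 ->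
    G `<=` Z1 `|` Z2 -> G `&` Z1 `&` Z2 = set0 ->
    G `<=` Z1 \/ G `<=` Z2.

Definition zariski_dense_in (K : fieldType) (n : nat)
    (S G : set 'M[K]_n) : Prop :=
  S `<=` G /\ forall Z, zariski_closed Z -> S `<=` Z -> G `<=` Z.

(* [lim] returns an arbitrary matrix when the series diverges; over the complex
   numbers it always converges. *)
Definition expmx (K : numFieldType) (n : nat) (A : 'M[K]_n) : 'M[K]_n :=
  limn (series (fun k => (k`!%:R)^-1 *: A ^+ k)).

(* Over the complex numbers, semisimple means [diagonalizable]. *)
Definition toral (R : realType) (n : nat) (G : set 'M[R[i]]_n) : Prop :=
  [/\ linear_algebraic_group G,
      zariski_connected G
    & exists B : 'M[R[i]]_n, diagonalizable B /\
        zariski_dense_in [set expmx (t%:C *: B) | t in [set: R]] G].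

Definition diag_torus (K : fieldType) (s n : nat) (M : 'M[int]_(s, n)) :
    set 'M[K]_n :=
  [set A | exists a : 'I_s -> K, (forall i, a i != 0) /\
     A = \prod_(i < s) diag_mx (\row_(j < n) a i ^ M i j)].

(* Main.v *)
(* In Smith coordinates M is a rectangular diagonal matrix with nonzero diagonal,
   so divisibility of C^* shows that the relations indexed by ker M cut out G.

   Density: let g be the point of G whose parameters a_1, ..., a_s are distinct
   primes; its powers g^k are of the form exp(kB).  By unique factorization a
   monomial character of G is determined by its value at g, so a polynomial which
   vanishes at all g^k vanishes on G.

   Connectedness: two points of G are joined by a rational curve, along which
   polynomial functions become rational functions of one variable; hence G is
   irreducible. *)
Require Import Defs.
From mathcomp Require Import all_boot all_order all_algebra.
From mathcomp Require Import all_classical all_reals all_analysis.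
From mathcomp Require Import complex.
From mathcomp Require mpoly.
From mathcomp Require Import zify ring.
(* The canonical instances of mpoly are needed; its notations clash with those of
   mathcomp-analysis. *)
Import -(notations) mpoly.

Import Order.TTheory GRing.Theory Num.Theory.
Import numFieldNormedType.Exports.
Local Open Scope classical_set_scope.
Local Open Scope ring_scope.
Local Open Scope complex_scope.

(** * Monomial maps between tori, with integer exponent matrices *)

Definition monomx {K : fieldType} {s n : nat} (a : 'I_s -> K)
    (M : 'M[int]_(s, n)) (j : 'I_n) : K := \prod_(i < s) a i ^ M i j.

Lemma expfz_prod {K : fieldType} {I : Type} (r : seq I) (f : I -> K) (m : int) :
  (\prod_(i <- r) f i) ^ m = \prod_(i <- r) f i ^ m.
Proof.
by apply: (big_morph (fun x => x ^ m)) => [x y|]; rewrite ?exp1rz// expfzMl.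
Qed.

Lemma expfz_sum {K : fieldType} {I : Type} (r : seq I) (f : I -> int) (x : K) :
  x != 0 -> x ^ (\sum_(i <- r) f i) = \prod_(i <- r) x ^ f i.
Proof.
move=> x0; elim/big_rec2: _ => [|i y z _ <-]; first by rewrite expr0z.
by rewrite expfzDr.
Qed.

Lemma monomx_neq0 {K : fieldType} {s n : nat} (a : 'I_s -> K)
    (M : 'M[int]_(s, n)) j :
  (forall i, a i != 0) -> monomx a M j != 0.
Proof. by move=> a0; apply/prodf_neq0 => i _; rewrite expfz_neq0. Qed.

(** Lets unimodular integer matrices act as invertible changes of coordinates on tori, which is how
    the two outer factors of the Smith form are removed. *)
Lemma monomxM {K : fieldType} {s m n : nat} (a : 'I_s -> K)
    (M : 'M[int]_(s, m)) (N : 'M[int]_(m, n)) :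
  (forall i, a i != 0) -> monomx (monomx a M) N =1 monomx a (M *m N).
Proof.
move=> a0 k; rewrite /monomx.
under eq_bigr do rewrite expfz_prod.
rewrite exchange_big/=; apply: eq_bigr => i _.
rewrite mxE expfz_sum//; apply: eq_bigr => j _.
by rewrite exprz_exp.
Qed.

Lemma eq_monomx {K : fieldType} {s n : nat} (a b : 'I_s -> K)
    (M : 'M[int]_(s, n)) : a =1 b -> monomx a M =1 monomx b M.
Proof. by move=> ab j; apply: eq_bigr => i _; rewrite ab. Qed.

Lemma monomx1 {K : fieldType} {n : nat} (a : 'I_n -> K) :
  monomx a 1%:M =1 a.
Proof.
move=> j; rewrite /monomx (bigD1 j)//= mxE eqxx expr1z big1 ?mulr1// => i ij.
by rewrite mxE (negbTE ij) expr0z.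
Qed.

(** * Diagonal matrices and the parametrization of the torus *)

Definition torus_mx {K : fieldType} {s n : nat} (M : 'M[int]_(s, n))
  (a : 'I_s -> K) : 'M[K]_n := diag_mx (\row_j monomx a M j).

Lemma prod_diag_mx {K : fieldType} {s n : nat} (f : 'I_s -> 'rV[K]_n) :
  \prod_(i < s) diag_mx (f i) = diag_mx (\row_j \prod_(i < s) f i 0 j).
Proof.
suff H (r : seq 'I_s) :
    \prod_(i <- r) diag_mx (f i) = diag_mx (\row_j \prod_(i <- r) f i 0 j).
  exact: H.
elim: r => [|i r IH].
  by apply/matrixP => j k; rewrite big_nil !mxE big_nil; case: eqVneq.
rewrite big_cons IH; apply/matrixP => j k.
rewrite [LHS]mxE (bigD1 j)//= big1 ?addr0; last first.
  by move=> l lj; rewrite !mxE eq_sym (negbTE lj) mul0r.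
by rewrite !mxE eqxx big_cons; case: (j == k); rewrite ?mulr1n// !mulr0n mulr0.
Qed.

Lemma diag_torusP {K : fieldType} {s n : nat} (M : 'M[int]_(s, n))
    (A : 'M[K]_n) :
  diag_torus M A <-> exists2 a : 'I_s -> K, (forall i, a i != 0)
    & A = torus_mx M a.
Proof.
have E (a : 'I_s -> K) : \prod_(i < s) diag_mx (\row_(j < n) a i ^ M i j) =
    torus_mx M a.
  rewrite prod_diag_mx; congr diag_mx; apply/rowP => j; rewrite !mxE.
  by apply: eq_bigr => i _; rewrite mxE.
by split=> [[a [a0 ->]]|[a a0 ->]]; exists a; rewrite ?E.
Qed.

Lemma offdiag0_diag_mx {K : fieldType} {n : nat} (A : 'M[K]_n) :
  (forall i j, i != j -> A i j = 0) -> A = diag_mx (\row_j A j j).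
Proof.
by move=> Ad; apply/matrixP => i j; rewrite !mxE; case: eqVneq => [->|/Ad].
Qed.

Lemma unitmx_diag_neq0 {K : fieldType} {n : nat} (A : 'M[K]_n) :
  A \in unitmx -> (forall i j, i != j -> A i j = 0) -> forall i, A i i != 0.
Proof.
move=> Au /offdiag0_diag_mx AE i; move: Au.
rewrite AE unitmxE det_diag unitfE => /prodf_neq0/(_ i isT).
by rewrite !mxE eqxx.
Qed.

(** * Defining relations from the Smith normal form *)

Lemma closed_field_root {K : closedFieldType} (m : int) (x : K) :
  m != 0 -> x != 0 -> exists2 z : K, z != 0 & z ^ m = x.
Proof.
have H (k : nat) (y : K) : y != 0 -> exists2 z : K, z != 0 & z ^+ k.+1 = y.
  move=> y0; have /closed_rootP[z] : size ('X^(k.+1) - y%:P) != 1%N.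
    by rewrite size_XnsubC.
  rewrite /root !hornerE subr_eq0 => /eqP zE.
  exists z => //; apply: contraNneq y0 => z0.
  by rewrite -zE z0 expr0n.
case: m => [[//|k]|k] _ x0; first exact: H.
have [z z0 zE] := H k (x^-1) (invr_neq0 x0).
by exists z => //; rewrite NegzE -invr_expz -exprnP zE invrK.
Qed.

(** Write [M = L D U]. In the coordinates [u] given by [invmx U], the relations from the kernel say
    that all entries past the first [s] are 1. The first [s] entries have roots of orders [d_k], and
    [invmx L] carries these roots to the required parameters. *)
Lemma monomx_image {K : closedFieldType} {s n : nat} (M : 'M[int]_(s, n))
    (t : 'I_n -> K) :
  (s <= n)%N ->
  \rank (map_mx (fun m : int => m%:~R : rat) M) = s ->
  (forall j, t j != 0) ->
  (forall d : 'cV[int]_n, M *m d = 0 -> \prod_(i < n) t i ^ d i 0 = 1) ->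
  exists2 a : 'I_s -> K, (forall i, a i != 0) & t =1 monomx a M.
Proof.
move=> sn rkM t0 ker.
have [L Lu [U Uu [d _ ME]]] := int_Smith_normal_form M.
set D := (\matrix_(i, j) _) in ME.
pose Q : {rmorphism int -> rat} := intmul 1.
have rkQ : \rank (map_mx Q M) = s by [].
have unitQ m (P : 'M[int]_m) : P \in unitmx -> map_mx Q P \in unitmx.
  by move=> Pu; rewrite unitmxE det_map_mx rmorph_unit.
(* Full row rank of [M] passes to [D]; a zero invariant factor would give [D] a zero row. *)
have d0 (k : 'I_s) : d`_k != 0.
  have Dfree : row_free (map_mx Q D).
    have UQ : row_free (map_mx Q U) by rewrite row_free_unit unitQ.
    have LQ : row_full (map_mx Q L) by rewrite row_full_unit unitQ.
    rewrite /row_free -[X in _ == X]rkQ ME !map_mxM mxrankMfree//.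
    by rewrite (eqmxMfull _ LQ).
  apply/eqP => dk0.
  have : delta_mx 0 k *m map_mx Q D = 0 :> 'rV_n.
    by apply/rowP => j; rewrite -rowE !mxE dk0 mul0rn.
  move=> /eqP; rewrite mulmx_free_eq0// => /eqP/rowP/(_ k)/eqP.
  by rewrite !mxE !eqxx oner_eq0.
pose u := monomx t (invmx U).
have u0 j : u j != 0 by apply: monomx_neq0.
(* Since [M *m invmx U = L *m D] and column [j] of [D] is zero for [s <= j], column [j] of [invmx U]
   lies in the kernel of [M]. *)
have u1 (j : 'I_n) : (s <= j)%N -> u j = 1.
  move=> sj; rewrite -[RHS](ker (col j (invmx U))).
    by apply: eq_bigr => i _; rewrite mxE.
  rewrite colE mulmxA ME mulmxK// -mulmxA -colE; apply/colP => i.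
  rewrite !mxE big1// => k _; rewrite !mxE [_ == _ :> nat]ltn_eqF ?mulr0//.
  exact: leq_trans sj.
have /boolp.choice[b bP] : forall k : 'I_s, exists z : K,
    z != 0 /\ z ^ d`_k = u (widen_ord sn k).
  move=> k.
  have [z z0 zE] := closed_field_root _ _ (d0 k) (u0 (widen_ord sn k)).
  by exists z.
have b0 k : b k != 0 by case: (bP k).
exists (monomx b (invmx L)) => [i|j]; first exact: monomx_neq0.
have bD : monomx b D =1 u.
  move=> k; have [sk|ks] := leqP s k.
    rewrite u1// /monomx big1// => i _.
    rewrite mxE [_ == _ :> nat]ltn_eqF ?expr0z//.
    exact: leq_trans sk.
  rewrite /monomx (bigD1 (Ordinal ks))//= mxE eqxx mulr1n (bP (Ordinal ks)).2.
  rewrite big1 ?mulr1 => [|i]; first by congr u; apply: val_inj.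
  by rewrite -val_eqE/= mxE => /negbTE ->; rewrite expr0z.
rewrite monomxM// ME 2!mulmxA mulVmx// mul1mx -monomxM//.
by rewrite (eq_monomx _ _ _ bD) monomxM// mulVmx// monomx1.
Qed.

Lemma monomx_ker {K : fieldType} {s n : nat} (M : 'M[int]_(s, n))
    (a : 'I_s -> K) (d : 'cV[int]_n) :
  (forall i, a i != 0) -> M *m d = 0 -> \prod_(j < n) monomx a M j ^ d j 0 = 1.
Proof.
move=> a0 Md; rewrite -[LHS]/(monomx (monomx a M) d 0) monomxM// Md.
by rewrite /monomx big1// => i _; rewrite mxE.
Qed.

Lemma diag_torus_equations {K : closedFieldType} {s n : nat}
    (M : 'M[int]_(s, n)) (A : 'M[K]_n) :
  (s <= n)%N ->
  \rank (map_mx (fun m : int => m%:~R : rat) M) = s ->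
  A \in unitmx ->
  diag_torus M A <->
    (forall i j : 'I_n, i != j -> A i j = 0) /\
    (forall d : 'cV[int]_n, M *m d = 0 -> \prod_(i < n) A i i ^ d i 0 = 1).
Proof.
move=> sn rkM Au; rewrite diag_torusP; split=> [[a a0 ->]|[Adiag Aker]].
  split=> [i j ij|d Md]; first by rewrite mxE (negbTE ij).
  rewrite -[RHS](monomx_ker M a d)//.
  by apply: eq_bigr => i _; rewrite !mxE eqxx.
have A0 := unitmx_diag_neq0 _ Au Adiag.
have [a a0 aE] := monomx_image M (fun j => A j j) sn rkM A0 Aker.
exists a => //; rewrite (offdiag0_diag_mx _ Adiag); congr diag_mx.
by apply/rowP => j; rewrite !mxE aE.
Qed.

(** * Group structure *)

Lemma monomx_mul {K : fieldType} {s n : nat} (a b : 'I_s -> K)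
    (M : 'M[int]_(s, n)) j :
  monomx (fun i => a i * b i) M j = monomx a M j * monomx b M j.
Proof. by rewrite -big_split; apply: eq_bigr => i _; rewrite expfzMl. Qed.

Lemma monomx_cst1 {K : fieldType} {s n : nat} (M : 'M[int]_(s, n)) j :
  monomx (fun=> 1 : K) M j = 1.
Proof. by rewrite /monomx big1// => i _; rewrite exp1rz. Qed.

Lemma diag_torus_unitmx {K : fieldType} {s n : nat} (M : 'M[int]_(s, n)) :
  diag_torus M `<=` @GLset K n.
Proof.
move=> A /diag_torusP[a a0 ->]; rewrite /GLset/= unitmxE det_diag unitfE.
by apply/prodf_neq0 => j _; rewrite mxE monomx_neq0.
Qed.

Lemma diag_torus_subgroup {K : fieldType} {s n : nat} (M : 'M[int]_(s, n)) :
  GL_subgroup (@diag_torus K s n M).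
Proof.
have D1 : diag_torus M (1%:M : 'M[K]_n).
  apply/diag_torusP; exists (fun=> 1) => [i|]; first exact: oner_neq0.
  rewrite -diag_const_mx; congr diag_mx.
  by apply/rowP => j; rewrite !mxE monomx_cst1.
have DM (A B : 'M[K]_n) : 
    diag_torus M A -> diag_torus M B -> diag_torus M (A *m B).
  move=> /diag_torusP[a a0 ->] /diag_torusP[b b0 ->]; apply/diag_torusP.
  exists (fun i => a i * b i) => [i|]; first by rewrite mulf_neq0.
  rewrite mulmx_diag; congr diag_mx; apply/rowP => j.
  by rewrite !mxE monomx_mul.
split=> //; first exact: diag_torus_unitmx.
move=> A DA; have Au := diag_torus_unitmx M _ DA.
case/diag_torusP: DA Au => [a a0 ->] Au.
have -> : invmx (diag_mx (\row_j monomx a M j)) =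
    diag_mx (\row_j monomx (fun i => (a i)^-1) M j).
  apply: (can_inj (mulKmx Au)); rewrite mulmxV// mulmx_diag -diag_const_mx.
  congr diag_mx; apply/rowP => j; rewrite !mxE -monomx_mul.
  rewrite -(monomx_cst1 M j); apply: eq_monomx => i.
  by rewrite divff.
by apply/diag_torusP; exists (fun i => (a i)^-1) => // i; rewrite invr_eq0.
Qed.

(** * Zariski closedness *)

Lemma mx_mevalX {K : fieldType} {n : nat} (i j : 'I_n) (A : 'M[K]_n) :
  mx_meval (mpoly.mpolyX K (mpoly.mnm1 (mxvec_index i j))) A = A i j.
Proof. by rewrite /mx_meval mpoly.mevalXU mxvecE. Qed.

(** Moving the negative parts of the exponents to the other side turns a Laurent monomial relation
    into a polynomial one. *)
Lemma prod_exprz_eq1 {K : fieldType} {n : nat} (t : 'I_n -> K)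
    (d : 'I_n -> int) :
  (forall i, t i != 0) ->
  (\prod_i t i ^ d i == 1) =
  (\prod_i t i ^+ `|Num.max (d i) 0|%N ==
   \prod_i t i ^+ `|Num.max (- d i) 0|%N).
Proof.
move=> t0.
have N0 : \prod_i t i ^+ `|Num.max (- d i) 0|%N != 0.
  by apply/prodf_neq0 => i _; rewrite expf_neq0.
rewrite -(inj_eq (mulIf N0)) mul1r -big_split; congr (_ == _).
apply: eq_bigr => i _ /=; rewrite exprnP -expfzDr// exprnP; congr (_ ^ _).
lia.
Qed.

Lemma diag_torus_closed {K : closedFieldType} {s n : nat} (M : 'M[int]_(s, n)) :
  (s <= n)%N ->
  \rank (map_mx (fun m : int => m%:~R : rat) M) = s ->
  zariski_closed (@diag_torus K s n M).
Proof.
move=> sn rkM.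
pose X (i j : 'I_n) := mpoly.mpolyX K (mpoly.mnm1 (mxvec_index i j)).
pose P (d : 'I_n -> int) := \prod_i X i i ^+ `|Num.max (d i) 0|%N.
(* The equations are the off-diagonal variables and, for each kernel vector, the binomial formed
   from its positive and negative parts. *)
exists [set p | (exists2 ij : 'I_n * 'I_n, ij.1 != ij.2 & p = X ij.1 ij.2) \/
  (exists2 d : 'cV[int]_n, M *m d = 0 &
     p = P (fun i => d i 0) - P (fun i => - d i 0))].
have PE d (A : 'M[K]_n) : mx_meval (P d) A =
    \prod_i A i i ^+ `|Num.max (d i) 0|%N.
  rewrite /mx_meval rmorph_prod/=; apply: eq_bigr => i _.
  by rewrite rmorphXn -[X in X ^+ _]/(mx_meval _ A) mx_mevalX.
have PBE d (A : 'M[K]_n) : mx_meval (P d - P (fun i => - d i)) A =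
    mx_meval (P d) A - mx_meval (P (fun i => - d i)) A.
  exact: rmorphB.
have dE (A : 'M[K]_n) (d : 'I_n -> int) : (forall i, A i i != 0) ->
    (\prod_i A i i ^ d i == 1) = (mx_meval (P d - P (fun i => - d i)) A == 0).
  by move=> A0; rewrite prod_exprz_eq1// PBE subr_eq0 !PE.
apply/seteqP; split=> A.
  move=> DA; have Au := diag_torus_unitmx M _ DA; split => // p.
  have /(diag_torus_equations _ _ sn rkM Au) [Ad Ak] := DA.
  move=> -[[[i j] /= ij ->]|[d Md ->]]; first by rewrite mx_mevalX Ad.
  by apply/eqP; rewrite -dE ?Ak//; exact: unitmx_diag_neq0.
move=> [Au AS]; apply/(diag_torus_equations _ _ sn rkM Au).
have Ad i j : i != j -> A i j = 0.
  by move=> ij; rewrite -mx_mevalX; apply: AS; left; exists (i, j).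
split=> // d Md; apply/eqP; rewrite dE; last exact: unitmx_diag_neq0.
by apply/eqP/AS; right; exists d.
Qed.

(** * Zariski density of the powers of a point *)

(** Newton interpolation, one node at a time. Nodes may coincide, and the hypothesis makes the
    prescribed values coincide with them. *)
Lemma exists_interpolation {K : fieldType} {I : eqType} (r : seq I)
    (f g : I -> K) :
  (forall x y, f x = f y -> g x = g y) ->
  exists q : {poly K}, forall x, x \in r -> q.[f x] = g x.
Proof.
move=> fg; elim: r => [|x r [q qE]]; first by exists 0.
have [/mapP[y yr fxy]|fx] := boolP (f x \in map f r).
  exists q => z; rewrite inE => /predU1P[->|]; last exact: qE.
  by rewrite fxy qE// (fg _ _ fxy).
(* A multiple of [w] corrects the value at the new node without disturbing the earlier ones. *)
pose w := \prod_(y <- map f r) ('X - y%:P).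
have w0 : w.[f x] != 0 by rewrite -[_ == 0]/(root w (f x)) root_prod_XsubC.
exists (q + ((g x - q.[f x]) / w.[f x])%:P * w) => z.
rewrite inE => /predU1P[->|zr]; first by rewrite !hornerE divfK// addrC subrK.
have /eqP wz : root w (f z) by rewrite root_prod_XsubC map_f.
by rewrite !hornerE wz mulr0 addr0 qE.
Qed.

(** The monomial [m] in the matrix entries, restricted to the torus: a character, or zero once an
    off-diagonal entry occurs in it. *)
Definition torus_char {K : fieldType} {s n : nat} (M : 'M[int]_(s, n))
    (m : mpoly.multinom (n * n)) (a : 'I_s -> K) : K :=
  \prod_k mxvec (torus_mx M a) 0 k ^+ m k.

Lemma mx_meval_torus {K : fieldType} {s n : nat} (M : 'M[int]_(s, n)) p
    (a : 'I_s -> K) :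
  mx_meval p (torus_mx M a) =
  \sum_(m <- mpoly.msupp p) mpoly.mcoeff m p * torus_char M m a.
Proof. by rewrite /mx_meval mpoly.mevalE. Qed.

Lemma torus_mx_entry {K : fieldType} {s n : nat} (M : 'M[int]_(s, n)) k :
  (forall a : 'I_s -> K, mxvec (torus_mx M a) 0 k = 0) \/
  exists j, forall a : 'I_s -> K, mxvec (torus_mx M a) 0 k = monomx a M j.
Proof.
case/mxvec_indexP: k => i j; have [<-|ij] := eqVneq i j.
  by right; exists i => a; rewrite mxvecE !mxE eqxx.
by left => a; rewrite mxvecE !mxE (negbTE ij).
Qed.

Lemma torus_charE {K : fieldType} {s n : nat} (M : 'M[int]_(s, n)) m :
  (forall a : 'I_s -> K, torus_char M m a = 0) \/
  exists e : 'I_s -> int, forall a : 'I_s -> K, (forall i, a i != 0) ->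
    torus_char M m a = \prod_i a i ^ e i.
Proof.
rewrite /torus_char; elim: (index_enum _) => [|k r IH].
  by right; exists (fun=> 0) => a a0; rewrite big_nil big1.
case: IH => [IH|[e IH]]; first by left=> a; rewrite big_cons IH mulr0.
(* A variable with exponent 0 contributes the factor 1 even when its entry is identically zero. *)
case: (posnP (m k)) => [mk|mk].
  by right; exists e => a a0; rewrite big_cons mk expr0 mul1r IH.
have [k0|[j kE]] := @torus_mx_entry K _ _ M k.
  by left=> a; rewrite big_cons k0 expr0n gtn_eqF// mul0r.
right; exists (fun i => M i j * (m k)%:Z + e i) => a a0.
rewrite big_cons IH// kE -prodrXl -big_split; apply: eq_bigr => i _ /=.
by rewrite expfzDr// -exprz_exp exprnP.
Qed.

(** The exponent is a successor because the identity fails at exponent 0 for monomials that vanish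
    on the torus. *)
Lemma torus_charX {K : fieldType} {s n : nat} (M : 'M[int]_(s, n)) m
    (a : 'I_s -> K) k : (forall i, a i != 0) ->
  torus_char M m (fun i => a i ^+ k.+1) = torus_char M m a ^+ k.+1.
Proof.
move=> a0; case: (@torus_charE K _ _ M m) => [z|[e eE]].
  by rewrite !z expr0n.
rewrite !eE// -?prodrXl => [|i]; last exact: expf_neq0.
by apply: eq_bigr => i _; rewrite exprnP exprz_exp mulrC -exprz_exp -exprnP.
Qed.

Definition mult_independent {K : fieldType} {s : nat} (g : 'I_s -> K) : Prop :=
  forall e : 'I_s -> int, \prod_i g i ^ e i = 1 -> forall i, e i = 0.

(* The value chi(g) of a character chi determines chi, hence chi(a); so chi(a)
   is a polynomial in chi(g) which is the same for all characters occurring in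
   p, and p(a) is a linear combination of the values p(g^k). *)
Lemma torus_dense_powers {K : fieldType} {s n : nat} (M : 'M[int]_(s, n))
    (g : 'I_s -> K) p :
  (forall i, g i != 0) -> mult_independent g ->
  (forall k, mx_meval p (torus_mx M (fun i => g i ^+ k)) = 0) ->
  forall a : 'I_s -> K, (forall i, a i != 0) -> mx_meval p (torus_mx M a) = 0.
Proof.
move=> g0 gind pg a a0.
(* Interpolating the quotient, not [torus_char M m a] itself, leaves a factor [torus_char M m g];
   hence only positive powers of [g] appear, as [torus_charX] demands. *)
have sep m m' : torus_char M m g = torus_char M m' g ->
    torus_char M m a / torus_char M m g = torus_char M m' a / torus_char M m' g.
  have P0 (e : 'I_s -> int) : \prod_i g i ^ e i != 0.
    by apply/prodf_neq0 => i _; rewrite expfz_neq0.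
  move=> mm'; rewrite -mm'; congr (_ / _); move: mm'.
  case: (@torus_charE K _ _ M m) => [z|[e eE]];
    case: (@torus_charE K _ _ M m') => [z'|[e' eE']].
  - by rewrite !z !z'.
  - by rewrite z eE'// => /esym/eqP; rewrite (negbTE (P0 _)).
  - by rewrite z' eE// => /eqP; rewrite (negbTE (P0 _)).
  rewrite !eE// !eE'// => H; apply: eq_bigr => i _; congr (_ ^ _).
  apply/eqP; rewrite -subr_eq0; apply/eqP; apply: (gind (fun i => e i - e' i)).
  rewrite -[RHS](divff (P0 e')) -{1}H -prodf_div; apply: eq_bigr => j _.
  by rewrite expfzDr// invr_expz.
have [q qE] := exists_interpolation (mpoly.msupp p) _ _ sep.
have qaE m : m \in mpoly.msupp p -> torus_char M m a =
    \sum_(k < size q) q`_k * torus_char M m (fun i => g i ^+ k.+1).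
  move=> mp; under eq_bigr do rewrite torus_charX// exprSr mulrA.
  rewrite -mulr_suml -horner_coef qE//.
  have [m0|m0] := eqVneq (torus_char M m g) 0; last by rewrite divfK.
  (* A genuine character cannot vanish at [g], so here the monomial is zero on the whole torus. *)
  rewrite m0 mulr0; case: (@torus_charE K _ _ M m) => [//|[e eE]].
  move/eqP: m0; rewrite eE// => /prodf_eq0/=[i _].
  by rewrite expfz_eq0 (negbTE (g0 i)) andbF.
rewrite mx_meval_torus big_seq.
under eq_bigr => m mp do rewrite qaE// mulr_sumr.
rewrite -big_seq exchange_big/= big1// => k _.
under eq_bigr do rewrite mulrCA.
by rewrite -mulr_sumr -mx_meval_torus pg mulr0.
Qed.

(** * Irreducibility and connectedness *)

(** Functions coming from the localization of [{poly K}] at [D], with the denominator cleared;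
    nothing is asked at the zeros of [D]. *)
Definition poly_frac {K : fieldType} (D : {poly K}) (f : K -> K) : Prop :=
  exists e (r : {poly K}), forall z, D.[z] != 0 -> f z * D.[z] ^+ e = r.[z].

Lemma poly_fracC {K : fieldType} (D : {poly K}) c : poly_frac D (fun=> c).
Proof. by exists 0%N, c%:P => z _; rewrite hornerC expr0 mulr1. Qed.

Lemma poly_fracD {K : fieldType} (D : {poly K}) f g :
  poly_frac D f -> poly_frac D g -> poly_frac D (fun z => f z + g z).
Proof.
move=> [e [r rE]] [e' [r' rE']]; exists (e + e')%N, (r * D ^+ e' + r' * D ^+ e).
move=> z Dz; rewrite !hornerE -rE// -rE'// exprD; ring.
Qed.

Lemma poly_fracM {K : fieldType} (D : {poly K}) f g :
  poly_frac D f -> poly_frac D g -> poly_frac D (fun z => f z * g z).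
Proof.
move=> [e [r rE]] [e' [r' rE']]; exists (e + e')%N, (r * r').
by move=> z Dz; rewrite hornerM -rE// -rE'// exprD mulrACA.
Qed.

Lemma poly_frac_prod {K : fieldType} {I : Type} (D : {poly K}) (r : seq I)
    (f : I -> K -> K) :
  (forall i, poly_frac D (f i)) -> poly_frac D (fun z => \prod_(i <- r) f i z).
Proof.
move=> fD; elim: r => [|i r IH].
  have [e [q qE]] := poly_fracC D 1.
  by exists e, q => z Dz; rewrite big_nil qE.
have [e [q qE]] := poly_fracM D _ _ (fD i) IH.
by exists e, q => z Dz; rewrite big_cons qE.
Qed.

Lemma poly_frac_sum {K : fieldType} {I : Type} (D : {poly K}) (r : seq I)
    (f : I -> K -> K) :
  (forall i, poly_frac D (f i)) -> poly_frac D (fun z => \sum_(i <- r) f i z).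
Proof.
move=> fD; elim: r => [|i r IH].
  have [e [q qE]] := poly_fracC D 0.
  by exists e, q => z Dz; rewrite big_nil qE.
have [e [q qE]] := poly_fracD D _ _ (fD i) IH.
by exists e, q => z Dz; rewrite big_cons qE.
Qed.

(** For negative exponents, the inverse of [c] is [D %/ c] divided by [D]. *)
Lemma poly_fracXz {K : fieldType} (D c : {poly K}) (m : int) :
  c %| D -> poly_frac D (fun z => c.[z] ^ m).
Proof.
move=> cD; case: m => k.
  by exists 0%N, (c ^+ k) => z _; rewrite horner_exp mulr1.
exists k.+1, ((D %/ c) ^+ k.+1) => z Dz.
rewrite NegzE -invr_expz -exprnP horner_exp -exprVn -exprMn; congr (_ ^+ _).
have DE := divpK cD.
have c0 : c.[z] != 0.
  by apply: contraNneq Dz => c0; rewrite -DE hornerM c0 mulr0.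
by rewrite -{1}DE hornerM mulrC mulfK.
Qed.

Lemma torus_irreducible {K : closedFieldType} {s n : nat} (M : 'M[int]_(s, n))
    p1 p2 (a1 a2 : 'I_s -> K) :
  (forall i, a1 i != 0) -> (forall i, a2 i != 0) ->
  mx_meval p1 (torus_mx M a1) != 0 -> mx_meval p2 (torus_mx M a2) != 0 ->
  exists2 a : 'I_s -> K, (forall i, a i != 0) &
    mx_meval p1 (torus_mx M a) != 0 /\ mx_meval p2 (torus_mx M a) != 0.
Proof.
move=> a10 a20 p10 p20.
(* The line through [a1] at 0 and [a2] at 1; it stays in the torus wherever [D], the product of its
   coordinates, is nonzero. *)
pose c i : {poly K} := (a1 i)%:P * (1 - 'X) + (a2 i)%:P * 'X.
pose D := \prod_i c i.
have cz0 i : (c i).[0] = a1 i by rewrite !hornerE subr0 mulr1.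
have cz1 i : (c i).[1] = a2 i by rewrite !hornerE subrr mulr0 add0r.
have D0 : D.[0] != 0.
  by rewrite horner_prod; apply/prodf_neq0 => i _; rewrite cz0.
have D1 : D.[1] != 0.
  by rewrite horner_prod; apply/prodf_neq0 => i _; rewrite cz1.
have cD i : c i %| D by rewrite /D (bigD1 i)//= dvdp_mulr.
have frac p :
    poly_frac D (fun z => mx_meval p (torus_mx M (fun i => (c i).[z]))).
  have [|e [r rE]] := poly_frac_sum D (mpoly.msupp p) (fun m z =>
      mpoly.mcoeff m p * torus_char M m (fun i => (c i).[z])).
    move=> m; apply: poly_fracM; first exact: poly_fracC.
    case: (@torus_charE K _ _ M m) => [m0|[x xE]].
      by exists 0%N, 0 => z _; rewrite m0 mul0r horner0.
    have [|e [r rE]] := poly_frac_prod D (index_enum 'I_s)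
        (fun i z => (c i).[z] ^ x i).
      by move=> i; exact: poly_fracXz.
    exists e, r => z Dz; rewrite -rE// xE// => i.
    by move: Dz; rewrite horner_prod => /prodf_neq0; apply.
  by exists e, r => z Dz; rewrite mx_meval_torus rE.
have [e1 [r1 r1E]] := frac p1; have [e2 [r2 r2E]] := frac p2.
have r10 : r1 != 0.
  apply/eqP => r0; move: (r1E 0 D0); rewrite r0 horner0 => /eqP.
  have -> : (fun i => (c i).[0]) = a1 by apply/funext.
  by rewrite mulf_eq0 (negbTE p10) expf_eq0 (negbTE D0) andbF.
have r20 : r2 != 0.
  apply/eqP => r0; move: (r2E 1 D1); rewrite r0 horner0 => /eqP.
  have -> : (fun i => (c i).[1]) = a2 by apply/funext.
  by rewrite mulf_eq0 (negbTE p20) expf_eq0 (negbTE D1) andbF.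
have Dn0 : D != 0 by apply: contraNneq D0 => ->; rewrite horner0.
(* The numerators are nonzero polynomials, by their values at 0 and 1 respectively, so some
   parameter avoids all the roots. *)
have /closed_nonrootP[z] : D * (r1 * r2) != 0 by rewrite !mulf_neq0.
rewrite !rootM !negb_or => /and3P[Dz r1z r2z].
exists (fun i => (c i).[z]) => [i|].
  by move: Dz; rewrite /root horner_prod => /prodf_neq0; apply.
split.
  by apply: contraNneq r1z => f0; rewrite /root -r1E// f0 mul0r.
by apply: contraNneq r2z => f0; rewrite /root -r2E// f0 mul0r.
Qed.

(** If neither closed set contains the torus, each has an equation failing somewhere on it. By
    irreducibility both fail at a common point, which contradicts the covering. *)
Lemma diag_torus_connected {K : closedFieldType} {s n : nat}
    (M : 'M[int]_(s, n)) :
  zariski_connected (@diag_torus K s n M).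
Proof.
move=> _ _ [S1 ->] [S2 ->] cover _.
have [|/existsNP[A1 /not_implyP[DA1 ZA1]]] := pselect (diag_torus M `<=`
  [set A | GLset A /\ forall p, S1 p -> mx_meval p A = 0]); first by left.
right => A2 DA2; split; first exact: diag_torus_unitmx DA2.
move=> p2 Sp2; apply/eqP/negPn/negP => p2A2.
have [p1 /not_implyP[Sp1 /eqP p1A1]] : exists p, ~ (S1 p -> mx_meval p A1 = 0).
  apply/existsNP => H; apply: ZA1; split => //; exact: diag_torus_unitmx DA1.
case/diag_torusP: DA1 p1A1 => a1 a10 ->.
case/diag_torusP: DA2 p2A2 => a2 a20 -> p2A p1A.
have [a a0 [h1 h2]] := torus_irreducible M _ _ _ _ a10 a20 p1A p2A.
case: (cover (torus_mx M a)) => [|[_ H]|[_ H]].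
- by apply/diag_torusP; exists a.
- by rewrite H ?eqxx in h1.
- by rewrite H ?eqxx in h2.
Qed.

(** * Exponentials of real diagonal matrices *)

Lemma cvg_mx {T : topologicalType} {m n : nat} {I : Type} (F : set_system I)
    {FF : Filter F} (f : I -> 'M[T]_(m, n)) (A : 'M[T]_(m, n)) :
  (forall i j, f x i j @[x --> F] --> A i j) -> f x @[x --> F] --> A.
Proof.
move=> fA U [P AP PU]; rewrite nbhs_filterE /=.
have : \forall x \near F, forall ij : 'I_m * 'I_n, P ij.1 ij.2 (f x ij.1 ij.2).
  by apply: filter_forall => -[i j]; apply: fA; exact: AP.
by apply: filterS => x H; apply: PU => i j; exact: (H (i, j)).
Qed.

Lemma cvg_real_complex {R : realType} {I : Type} (F : set_system I)
    {FF : Filter F} (f : I -> R) (x : R) :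
  f y @[y --> F] --> x ->
  ((f y)%:C : (R[i] : numFieldType)) @[y --> F] -->
     (x%:C : (R[i] : numFieldType)).
Proof.
(* In the order of [R[i]] a positive radius has zero imaginary part, so its real part serves as
   radius in [R]. *)
move=> fx; apply/cvgrPdist_lt => e; rewrite ltcE/= => /andP[/eqP e0 e1].
have := fx; move=> /cvgrPdist_lt/(_ _ e1); apply: filterS => y.
rewrite -rmorphB normc_def/= expr0n addr0 sqrtr_sqr.
by rewrite ltcE/= -e0 eqxx.
Qed.

Lemma diag_mxX {K : fieldType} {n : nat} (v : 'rV[K]_n) k :
  diag_mx v ^+ k = diag_mx (\row_j v 0 j ^+ k).
Proof.
elim: k => [|k IH].
  by rewrite expr0 -[1]diag_const_mx; congr diag_mx; apply/rowP => j;
    rewrite !mxE.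
rewrite exprS IH -[LHS]/(diag_mx _ *m diag_mx _) mulmx_diag; congr diag_mx.
by apply/rowP => j; rewrite !mxE exprS.
Qed.

Lemma expmx_eq {K : numFieldType} {n : nat} (A L : 'M[K]_n) :
  (forall i j, series (fun k => (k`!%:R)^-1 *: A ^+ k) N i j
     @[N --> \oo] --> L i j) ->
  expmx A = L.
Proof.
move=> AL; apply: cvg_lim; first exact: norm_hausdorff.
exact: cvg_mx.
Qed.

Lemma expmx_diag_real {R : realType} {n : nat} (x : 'I_n -> R) :
  expmx (diag_mx (\row_j (x j)%:C)) =
  diag_mx (\row_j (expR (x j))%:C) :> 'M[R[i]]_n.
Proof.
apply: expmx_eq => i j.
have -> : (fun k => series (fun k => (k`!%:R)^-1 *:
      (diag_mx (\row_j (x j)%:C) : 'M[R[i]]_n) ^+ k) k i j) =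
    (fun k => (if i == j then series (exp_coeff (x j)) k else 0)%:C).
  apply/funext => k; rewrite /series/= summxE.
  case: eqVneq => [->|ij]; last first.
    by rewrite big1 ?rmorph0// => l _; rewrite diag_mxX !mxE (negbTE ij) mulr0.
  rewrite rmorph_sum/=; apply: eq_bigr => l _.
  rewrite diag_mxX !mxE eqxx mulr1n /exp_coeff/= rmorphM/= fmorphV/= rmorphXn/=.
  by rewrite rmorph_nat mulrC.
rewrite !mxE; case: eqVneq => [->|ij]; last exact: cvg_cst.
by rewrite mulr1n; apply: cvg_real_complex; exact: is_cvg_series_exp_coeff.
Qed.

(** * Multiplicative independence of distinct primes *)

(** Some strictly increasing sequence of primes, possibly with gaps; only primality and injectivity
    matter. *)
Fixpoint nth_prime (k : nat) : nat :=
  s2val (prime_above (if k is k'.+1 then nth_prime k' else 0%N)).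

Lemma nth_prime_prime k : prime (nth_prime k).
Proof. by case: k => [|k] /=; case: prime_above. Qed.

Lemma nth_prime_inj : injective nth_prime.
Proof.
apply/incn_inj/leq_mono; apply: homo_ltn => [y x z|i].
  exact: ltn_trans.
by rewrite [nth_prime i.+1]/=; case: prime_above.
Qed.

Lemma logn_prod {I : Type} (p : nat) (r : seq I) (F : I -> nat) :
  (forall i, (0 < F i)%N) ->
  logn p (\prod_(i <- r) F i) = (\sum_(i <- r) logn p (F i))%N.
Proof.
move=> F0; elim: r => [|i r IH]; first by rewrite !big_nil logn1.
by rewrite !big_cons lognM ?IH// prodn_gt0.
Qed.

Lemma logn_prod_nth_prime {s : nat} (f : 'I_s -> nat) (j : 'I_s) :
  logn (nth_prime j) (\prod_(i < s) nth_prime i ^ f i) = f j.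
Proof.
rewrite logn_prod => [|i]; last by rewrite expn_gt0 prime_gt0// nth_prime_prime.
rewrite (bigD1 j)//= big1 ?addn0 => [|i ij];
    rewrite lognX logn_prime ?nth_prime_prime//.
  by rewrite eqxx muln1.
by rewrite (inj_eq nth_prime_inj) (inj_eq val_inj) eq_sym (negbTE ij) muln0.
Qed.

(** With negative exponents cleared, the relation is an equality of natural numbers. Valuations at
    each prime equate the positive and negative parts of its exponent, which is therefore 0. *)
Lemma nth_prime_mult_independent {K : numFieldType} {s : nat} :
  mult_independent (fun i : 'I_s => (nth_prime i)%:R : K).
Proof.
move=> e /eqP; rewrite prod_exprz_eq1 => [|i]; last first.
  by rewrite pnatr_eq0 -lt0n prime_gt0// nth_prime_prime.
under eq_bigr do rewrite -natrX.
under [X in _ == X]eq_bigr do rewrite -natrX.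
rewrite -!natr_prod eqr_nat => /eqP E j.
have := congr1 (logn (nth_prime j)) E; rewrite !logn_prod_nth_prime; lia.
Qed.

(** * The dense one-parameter subgroup *)

Lemma expR_mulz {R : realType} (x : R) (m : int) :
  expR (x * m%:~R) = expR x ^ m.
Proof.
case: m => k; first by rewrite -pmulrn expRM_natr.
by rewrite NegzE mulrNz mulrN expRN -pmulrn expRM_natr -invr_expz.
Qed.

(** The diagonal of the generator is the row vector [x] times [M], the image of [x] under the
    differential of the monomial map at the identity. *)
Lemma expmx_torus {R : realType} {s n : nat} (M : 'M[int]_(s, n))
    (x : 'I_s -> R) (t : R) :
  expmx (t%:C *: diag_mx (\row_j (\sum_i x i * (M i j)%:~R)%:C)) =
  torus_mx M (fun i => (expR (t * x i))%:C) :> 'M[R[i]]_n.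
Proof.
rewrite -linearZ/=.
rewrite (_ : _ *: _ = \row_j (t * \sum_i x i * (M i j)%:~R)%:C); last first.
  by apply/rowP => j; rewrite !mxE rmorphM.
rewrite expmx_diag_real /torus_mx; congr diag_mx; apply/rowP => j; rewrite !mxE.
rewrite mulr_sumr expR_sum rmorph_prod/=; apply: eq_bigr => i _.
by rewrite mulrA expR_mulz fmorphXz.
Qed.

Lemma diag_torus_one_parameter_dense {R : realType} {s n : nat}
    (M : 'M[int]_(s, n)) :
  exists B : 'M[R[i]]_n, diagonalizable B /\
    zariski_dense_in [set expmx (t%:C *: B) | t in [set: R]] (diag_torus M).
Proof.
pose p (i : 'I_s) : R := (nth_prime i)%:R.
have p0 i : 0 < p i by rewrite ltr0n prime_gt0// nth_prime_prime.
(* Logarithms of primes make the exponential at [t = 1] the torus point with prime parameters. *)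
exists (diag_mx (\row_j (\sum_i ln (p i) * (M i j)%:~R)%:C)); split.
  exists 1%:M; first exact: unitmx1.
  apply/diagonalizable_forP => [|i j ij]; first exact: unitmx1.
  by rewrite invmx1 mulmx1 mul1mx mxE -val_eqE (negbTE ij).
split=> [_ [t _ <-]|_ [S ->] SZ _ /diag_torusP[a a0 ->]].
  apply/diag_torusP; rewrite expmx_torus.
  exists (fun i => (expR (t * ln (p i)))%:C) => // i.
  by rewrite fmorph_eq0 gt_eqF// expR_gt0.
split=> [|q Sq].
  by apply: (diag_torus_unitmx M); apply/diag_torusP; exists a.
apply: (torus_dense_powers M (fun i => (nth_prime i)%:R)) => //.
  by move=> i; rewrite pnatr_eq0 -lt0n prime_gt0// nth_prime_prime.
  exact: nth_prime_mult_independent.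
move=> k.
have [|_ /(_ q Sq)//] := SZ (torus_mx M (fun i => (nth_prime i)%:R ^+ k)).
(* At the integer time [k] the one-parameter group passes through the [k]-th power of that point. *)
exists k%:R => //; rewrite expmx_torus; congr torus_mx; apply/funext => i.
by rewrite expRM_natl lnK ?posrE// rmorphXn/= rmorph_nat.
Qed.

Theorem proposition4p2p5 (R : realType) (s n : nat) (M : 'M[int]_(s, n))
    (hs : (1 <= s)%N) (hsn : (s < n)%N)
    (hM : \rank (map_mx (fun m : int => m%:~R : rat) M) = s) :
  toral (@diag_torus R[i] s n M) /\
  (forall A : 'M[R[i]]_n, A \in unitmx ->
     (diag_torus M A <->
      (forall i j : 'I_n, i != j -> A i j = 0) /\
      (forall d : 'cV[int]_n, M *m d = 0 ->
         \prod_(i < n) A i i ^ d i 0 = 1))).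
Proof.
have sn := ltnW hsn; split; last first.
  by move=> A Au; exact: diag_torus_equations.
split.
- split; [exact: diag_torus_subgroup | exact: diag_torus_closed].
- exact: diag_torus_connected.
- exact: diag_torus_one_parameter_dense.
Qed.
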